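(* Let $\Bbbk$ be a field, $\mathrm{G}$ an affine $\Bbbk$-group and $V$ a finite-dimensional $\mathrm{G}$-representation over $\Bbbk$. The linear subspaces $W\le V$ whose isotropy subgroups $\mathrm{G}_W\le \mathrm{G}$ operate trivially on $W$ constitute a constructible subset of the Grassmannian $\mathbb{G}(V)=\bigcup_{d}\mathbb{G}(d,V)$ of $V$.
   Context: $\mathbb{G}(d,V)$ is the Grassmannian of $d$-dimensional linear subspaces of $V$, a scheme defined over $\Bbbk$; $\mathbb{G}(V)$ is the disjoint union of the $\mathbb{G}(d,V)$, $0\le d\le\dim V$. The isotropy group of $W$ is $\mathrm{G}_W:=\{g\in \mathrm{G} : gW\le W\}$. Convention on points: following Borel's ''Linear algebraic groups'', schemes are considered over an algebraically closed field $\mathbb{K}\ge\Bbbk$ and carry $\Bbbk$-structures; points $W$ of $\mathbb{G}(V)$ and $g$ of $\mathrm{G}$ are $\mathbb{K}$-points (so $W\le V\otimes_{\Bbbk}\mathbb{K}$), and the topology is the Zariski topology. A subset of a topological space is locally closed if it is open in its closure, and constructible if it is a finite disjoint union of locally closed sets. *)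

(* Defs.v *)
From HB Require Import structures.
From mathcomp Require Import all_boot all_order all_algebra.
From mathcomp Require Import boolp classical_sets topology_structure.
From mathcomp Require Import mpoly.

Set Implicit Arguments.
Unset Strict Implicit.
Unset Printing Implicit Defensive.

Import GRing.Theory.
Local Open Scope ring_scope.
Local Open Scope classical_set_scope.

(* An affine k-group is given by its functor of points: the coordinate algebra
   [coord] is of finite type over k, and the sets Hom_k(coord, R) carry a group
   structure natural in the commutative k-algebra R. By Yoneda this is the same
   as a Hopf algebra structure on [coord]. Morphisms are compared pointwise. *)
Record affineGroup (k : fieldType) := AffineGroup {
  coord : comAlgType k;
  coord_finite_type : exists (m : nat) (f : {lrmorphism {mpoly k[m]} -> coord}),
    forall a, exists p, f p = a;
  gmul : forall R : comAlgType k, {lrmorphism coord -> R} ->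
    {lrmorphism coord -> R} -> {lrmorphism coord -> R};
  gone : forall R : comAlgType k, {lrmorphism coord -> R};
  ginv : forall R : comAlgType k, {lrmorphism coord -> R} ->
    {lrmorphism coord -> R};
  gmulA : forall (R : comAlgType k) (x y z : {lrmorphism coord -> R}),
    gmul x (gmul y z) =1 gmul (gmul x y) z;
  gmul1g : forall (R : comAlgType k) (x : {lrmorphism coord -> R}),
    gmul (gone R) x =1 x;
  gmulVg : forall (R : comAlgType k) (x : {lrmorphism coord -> R}),
    gmul (ginv x) x =1 gone R;
  gmul_natural : forall (R S : comAlgType k) (phi : {lrmorphism R -> S})
      (x y : {lrmorphism coord -> R}) (x' y' : {lrmorphism coord -> S}),
    x' =1 phi \o x -> y' =1 phi \o y -> gmul x' y' =1 phi \o gmul x y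
}.

Definition points (k : fieldType) (G : affineGroup k) (R : comAlgType k) :=
  {lrmorphism coord G -> R}.

(* A representation of G on V = k^n: a linear action of G(R) on V (x) R = R^n,
   natural in R. *)
Record representation (k : fieldType) (G : affineGroup k) (n : nat) :=
  Representation {
  rho : forall R : comAlgType k, points G R -> 'M[R]_n;
  rho1 : forall R : comAlgType k, rho (gone G R) = 1%:M;
  rhoM : forall (R : comAlgType k) (x y : points G R),
    rho (gmul x y) = rho x *m rho y;
  rho_natural : forall (R S : comAlgType k) (phi : {lrmorphism R -> S})
      (x : points G R) (x' : points G S),
    x' =1 phi \o x -> rho x' = map_mx phi (rho x)
}.

(* K regarded as a k-algebra through iota. *)
Definition algebra_along (k : fieldType) (K : closedFieldType)
  (iota : {rmorphism k -> K}) : Type := K.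

Section AlgebraAlong.
Variables (k : fieldType) (K : closedFieldType) (iota : {rmorphism k -> K}).

HB.instance Definition _ :=
  GRing.ClosedField.copy (algebra_along iota) K.

Let scale (a : k) (x : algebra_along iota) : algebra_along iota :=
  iota a * (x : K).

Let scaleA a b x : scale a (scale b x) = scale (a * b) x.
Proof. by rewrite /scale rmorphM mulrA. Qed.

Let scale1 : left_id 1 scale.
Proof. by move=> x; rewrite /scale rmorph1 mul1r. Qed.

Let scaleDr : right_distributive scale +%R.
Proof. by move=> a x y; rewrite /scale mulrDr. Qed.

Let scaleDl x : {morph scale^~ x : a b / a + b}.
Proof. by move=> a b; rewrite /scale rmorphD mulrDl. Qed.

HB.instance Definition _ :=
  GRing.Zmodule_isLmodule.Build k (algebra_along iota)
    scaleA scale1 scaleDr scaleDl.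

Let scaleAl (a : k) (x y : algebra_along iota) : a *: (x * y) = a *: x * y.
Proof. exact: mulrA. Qed.

HB.instance Definition _ :=
  GRing.Lmodule_isLalgebra.Build k (algebra_along iota) scaleAl.

HB.instance Definition _ :=
  GRing.Lalgebra_isComAlgebra.Build k (algebra_along iota).

End AlgebraAlong.

(* The K-points of the Grassmannian of all linear subspaces of K^n. *)
Definition grassmannian (K : fieldType) (n : nat) : Type := {vspace 'cV[K]_n}.

HB.instance Definition _ (K : fieldType) (n : nat) :=
  Choice.copy (grassmannian K n) {vspace 'cV[K]_n}.

(* The Pluecker coordinates of a d-dimensional W are the d x d minors of a
   matrix whose rows form a basis of W; a change of basis multiplies all of them
   by the same nonzero scalar. They are indexed here by all d-tuples of columns,
   not only by the increasing ones: the additional coordinates are 0 or, up to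
   sign, repetitions. *)
Definition plucker (K : fieldType) (n d : nat) (W : grassmannian K n)
    (i : 'I_#|{ffun 'I_d -> 'I_n}|) : K :=
  \det (\matrix_(a < d, b < d)
          (vbasis (W : {vspace 'cV[K]_n}))`_a (enum_val i b) 0).

(* Zariski closed: for every d, the part in G(d, n) is cut out by homogeneous
   polynomials in the Pluecker coordinates. *)
Definition zariski_closed (K : fieldType) (n : nat)
    (C : set (grassmannian K n)) : Prop :=
  forall d : nat, exists P : set {mpoly K[#|{ffun 'I_d -> 'I_n}|]},
    (forall p, P p -> exists e : nat, p \is e.-homog) /\
    (forall W : grassmannian K n, \dim W = d ->
       (C W <-> forall p, P p -> p.@[plucker W] = 0)).

Section ZariskiTopology.
Variables (K : fieldType) (n : nat).

Let op : set (set (grassmannian K n)) := [set U | zariski_closed (~` U)].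

Let opT : op setT.
Proof.
move=> d; exists [set 1]; split; first by move=> _ ->; exists 0; apply: dhomog1.
move=> W _; rewrite setCT; split=> // /(_ 1 erefl) /eqP.
by rewrite meval1 oner_eq0.
Qed.

Let opI : setI_closed op.
Proof.
move=> A B clA clB d; have [P [homP defA]] := clA d; have [Q [homQ defB]] := clB d.
exists [set r | exists p q, [/\ P p, Q q & r = p * q]]; split.
  move=> _ [p] [q] [/homP[e pe] /homQ[f qf] ->].
  by exists (e + f)%N; apply: dhomogM.
move=> W dW; rewrite setCI; split.
  move=> CW _ [p] [q] [Pp Qq ->]; rewrite mevalM.
  case: CW => [/(defA W dW)/(_ p Pp) ->|/(defB W dW)/(_ q Qq) ->].
    by rewrite mul0r.
  by rewrite mulr0.
move=> vPQ; have [AW|nAW] := pselect ((~` A) W); first by left.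
right; apply/(defB W dW) => q Qq; apply: contrapT => nq0.
apply: nAW; apply/(defA W dW) => p Pp.
have /eqP := vPQ _ (ex_intro _ p (ex_intro _ q (And3 Pp Qq erefl))).
by rewrite mevalM mulf_eq0 => /orP[/eqP //|/eqP/nq0].
Qed.

Let op_bigU (I : Type) (f : I -> set (grassmannian K n)) :
  (forall i, op (f i)) -> op (\bigcup_i f i).
Proof.
move=> opf d; have /choice[P defP] := fun i => opf i d.
exists (\bigcup_i P i); split; first by move=> p [i _]; apply: (defP i).1.
move=> W dW; rewrite setC_bigcup; split.
  by move=> CW p [i _ Pip]; apply: ((defP i).2 W dW).1 Pip; apply: CW.
by move=> vP i _; apply/((defP i).2 W dW) => p Pip; apply: vP; exists i.
Qed.

HB.instance Definition _ :=
  isOpenTopological.Build (grassmannian K n) opT opI op_bigU.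

End ZariskiTopology.

Definition locally_closed (T : topologicalType) (A : set T) : Prop :=
  exists2 U : set T, open U & A = U `&` closure A.

Definition constructible (T : topologicalType) (A : set T) : Prop :=
  exists (m : nat) (B : 'I_m -> set T),
    [/\ forall i, locally_closed (B i), trivIset setT B & A = \bigcup_i B i].

Section Isotropy.
Variables (k : fieldType) (K : closedFieldType) (iota : {rmorphism k -> K}).
Variables (G : affineGroup k) (n : nat) (V : representation G n).

Definition act (g : points G (algebra_along iota)) (w : 'cV[K]_n) : 'cV[K]_n :=
  (rho V g : 'M[K]_n) *m w.

Definition isotropy (W : grassmannian K n) : set (points G (algebra_along iota)) :=
  [set g | forall w, w \in (W : {vspace _}) -> act g w \in (W : {vspace _})].

Definition isotropy_trivial (W : grassmannian K n) : Prop :=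
  forall g, isotropy W g -> forall w, w \in (W : {vspace _}) -> act g w = w.

End Isotropy.

(* Main.v *)
Require Import Defs.
From HB Require Import structures.
From mathcomp Require Import all_boot all_order all_algebra.
From mathcomp Require Import closed_field.
From mathcomp Require Import boolp classical_sets topology_structure.
From mathcomp Require Import mpoly.

(* By Hilbert's basis theorem the K-points of G are the zeros in K^m of finitely
   many polynomials, and by Yoneda the matrix of a point on V is polynomial in
   its coordinates. On the chart of G(d, n) where the i-th Pluecker coordinate
   p_i is nonzero, W is spanned by a matrix whose entries are of the form
   p_j / p_i, so that "G_W operates trivially on W" becomes a first-order
   condition on the p_j / p_i. Quantifier elimination over K turns it into a
   condition on which of finitely many polynomials vanish; homogenized with
   respect to p_i they define closed subsets of the Grassmannian. Hence finitely
   many closed sets separate the points W of the given set from the others, and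
   that set is the disjoint union of some of the locally closed sets of the W
   that belong to prescribed members of this finite family and to no others. *)

Set Implicit Arguments.
Unset Strict Implicit.
Unset Printing Implicit Defensive.

Import GRing.Theory.
Local Open Scope ring_scope.

(** * Hilbert's basis theorem *)

Section Noetherian.
Implicit Types R S : comNzRingType.

Definition is_ideal R (J : R -> Prop) : Prop :=
  [/\ J 0, forall a b, J a -> J b -> J (a + b) & forall c a, J a -> J (c * a)].

(* [s] generates [J]: stated without linear combinations, as "every ideal that
   contains [s] contains [J]". *)
Definition noetherian R : Prop :=
  forall J : R -> Prop, is_ideal J ->
  exists2 s : seq R, (forall a, a \in s -> J a) &
    forall J' : R -> Prop, is_ideal J' -> (forall a, a \in s -> J' a) ->
    forall a, J a -> J' a.

Lemma noetherian_field (F : fieldType) : noetherian F.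
Proof.
move=> J [J0 JD JM]; have [[a [Ja a0]]|noJ] := pselect (exists a, J a /\ a != 0).
  exists [:: a] => [b|J' [_ _ J'M] sJ' b _]; first by rewrite inE => /eqP ->.
  by rewrite -[b](divfK a0); apply: J'M; apply: sJ'; rewrite inE.
exists [::] => // J' [J'0 _ _] _ a Ja; have [->//|a0] := eqVneq a 0.
by case: noJ; exists a.
Qed.

(** Ideals of [S] are pulled back along [phi], and generators are pushed forward. *)
Lemma noetherian_quotient R S (phi : {rmorphism R -> S}) :
  (forall b, exists a, phi a = b) -> noetherian R -> noetherian S.
Proof.
move=> phi_surj noethR J [J0 JD JM].
have pre_ideal (H : S -> Prop) : is_ideal H -> is_ideal (fun a => H (phi a)).
  case=> H0 HD HM; split=> [|a b Ha Hb|c a Ha]; first by rewrite rmorph0.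
  - by rewrite rmorphD; apply: HD.
  - by rewrite rmorphM; apply: HM.
have [s sJ genJ] := noethR _ (pre_ideal J (And3 J0 JD JM)).
exists (map phi s) => [_ /mapP[a /sJ Ja ->] //|J' J'id sJ' b].
have [a <-] := phi_surj b; move: a; apply: genJ; first exact: pre_ideal.
by move=> a sa; apply: sJ'; apply: map_f.
Qed.

(** The size is only bounded by [d.+1], so coefficient [d] may be 0. For an ideal [H] these
    coefficients therefore form an ideal, which grows with [d] on multiplying by powers of 'X. *)
Definition lead_ideal R (H : {poly R} -> Prop) (d : nat) (a : R) : Prop :=
  exists p : {poly R}, [/\ H p, (size p <= d.+1)%N & p`_d = a].

Lemma lead_ideal_ideal R (H : {poly R} -> Prop) d :
  is_ideal H -> is_ideal (lead_ideal H d).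
Proof.
case=> H0 HD HM; split=> [|_ _ [p [Hp sp <-]] [q [Hq sq <-]]|c _ [p [Hp sp <-]]].
- by exists 0; rewrite size_poly0 coef0.
- exists (p + q); rewrite coefD; split=> //; first exact: HD.
  by apply: leq_trans (size_polyD _ _) _; rewrite geq_max sp.
- exists (c%:P * p); rewrite coefCM; split=> //; first exact: HM.
  by rewrite mul_polyC; apply: leq_trans (size_scale_leq _ _) sp.
Qed.

Lemma lead_idealS R (H : {poly R} -> Prop) d e a :
  is_ideal H -> (d <= e)%N -> lead_ideal H d a -> lead_ideal H e a.
Proof.
case=> _ _ HM de [p [Hp sp <-]]; exists ('X^(e - d) * p); split; first exact: HM.
  apply: leq_trans (size_polyMleq _ _) _; rewrite size_polyXn /=.
  by apply: leq_trans (leq_add (leqnn _) sp) _; rewrite addnS subnK.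
by rewrite coefXnM ltnNge leq_subr /= subKn.
Qed.

Lemma idealI R (H H' : R -> Prop) :
  is_ideal H -> is_ideal H' -> is_ideal (fun a => H a /\ H' a).
Proof.
case=> H0 HD HM [H'0 H'D H'M]; split=> // [a b [] ? ? [] ? ?|c a [] ? ?].
  by split; [apply: HD|apply: H'D].
by split; [apply: HM|apply: H'M].
Qed.

(** Used to lift finitely many generators of an ideal of leading coefficients to polynomials, with
    no stray polynomial in the list. *)
Lemma seq_lift (A B : eqType) (P : A -> B -> Prop) (s : seq A) :
  (forall a, a \in s -> exists b, P a b) ->
  exists t : seq B, (forall b, b \in t -> exists2 a, a \in s & P a b) /\
    (forall a, a \in s -> exists2 b, b \in t & P a b).
Proof.
elim: s => [|a s IHs] sP; first by exists [::].
have [b Pab] := sP a (mem_head _ _).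
have [|t [ts st]] := IHs; first by move=> c sc; apply: sP; rewrite inE sc orbT.
exists (b :: t); split=> c; rewrite inE => /orP[/eqP ->|].
- by exists a => //; apply: mem_head.
- by case/ts=> a' sa' Pa'c; exists a' => //; rewrite inE sa' orbT.
- by exists b => //; apply: mem_head.
- by case/st=> b' tb' Pcb'; exists b' => //; rewrite inE tb' orbT.
Qed.

(** Hilbert's argument: the union of the leading ideals has finitely many generators, and their
    lifts serve every degree from some [N] on. Each of the finitely many degrees below [N] gets its
    own generators. Top coefficients are then cancelled by induction on the size. *)
Lemma noetherian_poly R : noetherian R -> noetherian {poly R}.
Proof.
move=> noethR J Jid.
(* Generation is tested against ideals, so it is applied to the leading ideal of the intersection of
   [J] and [J']: each leading coefficient of [J] is also attained inside [J']. *)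
have lead_gen d : exists t : seq {poly R}, (forall p, p \in t -> J p) /\
    forall J', is_ideal J' -> (forall p, p \in t -> J' p) ->
    forall a, lead_ideal J d a -> lead_ideal (fun p => J p /\ J' p) d a.
  have [s sL genL] := noethR _ (lead_ideal_ideal d Jid).
  have [t [ts st]] := seq_lift sL.
  exists t; split=> [p /ts[a _ []] //|J' J'id tJ'].
  apply: genL; first exact: lead_ideal_ideal (idealI Jid J'id).
  by move=> a /st[p tp [Jp sp pa]]; exists p; split=> //; split=> //; apply: tJ'.
have Lid : is_ideal (fun a => exists d, lead_ideal J d a).
  split.
  - by exists 0%N; have [] := lead_ideal_ideal 0 Jid.
  - move=> a b [d Ld] [e Le]; exists (maxn d e).
    have [_ LD _] := lead_ideal_ideal (maxn d e) Jid.
    apply: LD; first by apply: lead_idealS Ld; rewrite ?leq_maxl.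
    by apply: lead_idealS Le; rewrite ?leq_maxr.
  - move=> c a [d Ld]; exists d.
    by have [_ _ LM] := lead_ideal_ideal d Jid; apply: LM.
have [s sL genL] := noethR _ Lid.
have [|t [ts st]] := @seq_lift _ _ (fun a p => J p /\ lead_coef p = a) s.
  (* For [a = 0] the polynomial [p] may have another leading coefficient, so 0 is taken instead. *)
  move=> a /sL[d [p [Jp sp pda]]]; have [a0|a0] := eqVneq a 0.
    by exists 0; rewrite a0 lead_coef0; case: Jid.
  exists p; split=> //; rewrite -pda lead_coefE; congr _`_(_).
  suff -> : size p = d.+1 by [].
  apply/anti_leq; rewrite sp ltnNge; apply/negP => /(nth_default 0) pd0.
  by rewrite -pda pd0 eqxx in a0.
(* All lifts in [t] have degree below [N], so they can be shifted to any degree [d >= N]. *)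
pose N := (\max_(p <- t) size p)%N.
have [u genu] := choice lead_gen.
exists (t ++ flatten [seq u d | d <- iota 0 N]) => [p|J' J'id sJ'].
  rewrite mem_cat => /orP[/ts[a _ []] //|/flatten_mapP[d _]]; exact: (genu d).1.
have leadJ d a : lead_ideal J d a -> lead_ideal (fun p => J p /\ J' p) d a.
  have [ltdN|leNd] := ltnP d N.
    apply: (genu d).2 => // p up; apply: sJ'; rewrite mem_cat; apply/orP; right.
    by apply/flatten_mapP; exists d; rewrite ?mem_iota.
  move=> Lda; apply: genL (ex_intro _ d Lda).
    exact: lead_ideal_ideal (idealI Jid J'id).
  move=> b /st[p tp [Jp <-]].
  apply: (@lead_idealS _ _ (size p).-1); first exact: idealI.
    apply: leq_trans (leq_pred _) (leq_trans _ leNd).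
    exact: leq_bigmax_seq.
  by exists p; rewrite leqSpred; split=> //; split=> //; apply: sJ'; rewrite mem_cat tp.
have [[J0 JD JM] [J'0 J'D J'M]] := (Jid, J'id).
move=> p; have [d] := ubnP (size p); elim: d p => // d IHd p sp Jp.
case: d => [|d] in IHd sp *.
  by move: sp; rewrite ltnS leqn0 size_poly_eq0 => /eqP ->.
(* [q] agrees with [p] in the top coefficient, so [p - q] has smaller size. *)
have [q [[Jq J'q] sq qd]] := leadJ d p`_d (ex_intro _ p (And3 Jp sp erefl)).
rewrite -(subrK q p); apply: J'D => //; apply: IHd; last first.
  by apply: JD => //; rewrite -mulN1r; apply: JM.
rewrite ltnS; apply/leq_sizeP => i; rewrite leq_eqVlt => /orP[/eqP <-|ltdi].
  by rewrite coefB qd subrr.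
by rewrite coefB !nth_default ?subr0 //; apply: leq_trans ltdi.
Qed.

(** Induction on [n]: evaluating at the last variable maps polynomials over {mpoly R[n]} onto {mpoly
    R[n.+1]}, and surjectivity is enough. *)
Lemma noetherian_mpoly R n : noetherian R -> noetherian {mpoly R[n]}.
Proof.
move=> noethR; elim: n => [|n IHn].
  apply: (noetherian_quotient (phi := @mpolyC 0 R)) noethR => p.
  exists p@_0%MM; apply/mpolyP => m; rewrite mcoeffC.
  have -> : m = 0%MM by apply/mnmP; case.
  by rewrite eqxx mulr1.
pose phi : {rmorphism {poly {mpoly R[n]}} -> {mpoly R[n.+1]}} :=
  horner_eval 'X_ord_max \o map_poly (@mwiden n R).
apply: (noetherian_quotient (phi := phi)) (noetherian_poly IHn) => p.
have phiX i : exists p, phi p = 'X_i.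
  have [->|ne_max] := eqVneq i ord_max.
    by exists 'X; rewrite /= /horner_eval map_polyX hornerX.
  have ltin : (i < n)%N by rewrite ltn_neqAle -ltnS ltn_ord andbT; exact: ne_max.
  exists ('X_(Ordinal ltin))%:P; rewrite /= /horner_eval map_polyC hornerC /=.
  by rewrite mwidenX mnmwiden1; congr 'X_[U_(_)]; apply: val_inj.
have phiXm m : exists p, phi p = 'X_[m].
  rewrite mpolyXE_id; elim/big_ind: _ => [|_ _ [q1 <-] [q2 <-]|i _].
  - by exists 1; rewrite rmorph1.
  - by exists (q1 * q2); rewrite rmorphM.
  - by have [q <-] := phiX i; exists (q ^+ m i); rewrite rmorphXn.
elim/mpolyind: p => [|c m p _ _ [q <-]]; first by exists 0; rewrite rmorph0.
have [r <-] := phiXm m; exists (c%:MP%:P * r + q).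
by rewrite rmorphD rmorphM /= {1}/horner_eval map_polyC hornerC /= mwidenC mul_mpolyC.
Qed.

End Noetherian.

(** * Points of an affine group *)

Section Points.
Variables (k : fieldType) (K : closedFieldType) (iota : {rmorphism k -> K}).

(** [A] is the quotient of the polynomial ring by the kernel of [f], and [z] is a zero of that
    kernel. Evaluation at [z], computed on any chosen preimage, thus descends to [A]. *)
Lemma eval_lrmorphism (A : comAlgType k) m (f : {lrmorphism {mpoly k[m]} -> A})
    (z : 'I_m -> K) :
  (forall a, exists p, f p = a) -> (forall p, f p = 0 -> mmap iota z p = 0) ->
  exists g : {lrmorphism A -> algebra_along iota},
    forall p, g (f p) = mmap iota z p.
Proof.
move=> /choice[lift liftK] kerf.
pose ev (a : A) : algebra_along iota := mmap iota z (lift a).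
have evE p : ev (f p) = mmap iota z p.
  apply/eqP; rewrite -subr_eq0 /ev -mmapB; apply/eqP; apply: kerf.
  by rewrite rmorphB /= liftK subrr.
have evB : zmod_morphism ev.
  by move=> a b; rewrite -[a]liftK -[b]liftK -rmorphB !evE rmorphB.
have evM : monoid_morphism ev.
  split=> [|a b]; first by rewrite -(rmorph1 f) evE rmorph1.
  by rewrite -[a]liftK -[b]liftK -rmorphM !evE rmorphM.
have evZ : scalable ev.
  by move=> c a; rewrite -[a]liftK -linearZ !evE mmapZ.
pose g : {lrmorphism A -> algebra_along iota} := HB.pack ev
  (GRing.isZmodMorphism.Build _ _ ev evB)
  (GRing.isMonoidMorphism.Build _ _ ev evM)
  (GRing.isScalable.Build _ _ _ _ ev evZ).
by exists g.
Qed.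

Lemma lrmorphism_eval m (g : {lrmorphism {mpoly k[m]} -> algebra_along iota}) p :
  g p = mmap iota (fun i => (g 'X_i : K)) p.
Proof.
elim/mpolyind: p => [|c mm p _ _ IHp]; first by rewrite !rmorph0.
rewrite mmapD mmapZ linearD linearZ /= IHp; congr (_ * _ + _).
by rewrite mmapX mpolyXE_id rmorph_prod; apply: eq_bigr => i _; rewrite rmorphXn.
Qed.

Lemma points_closed (G : affineGroup k) n (V : representation G n) :
  exists (m : nat) (Z : seq {mpoly k[m]}) (Q : 'M[{mpoly k[m]}]_n),
  forall M : 'M[K]_n,
    (exists g : points G (algebra_along iota), rho V g = M) <->
    (exists z : 'I_m -> K, (forall p, p \in Z -> mmap iota z p = 0) /\
                           map_mx (mmap iota z) Q = M).
Proof.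
have [m [f f_surj]] := coord_finite_type G.
have ker_ideal : is_ideal (fun p => f p = 0).
  split=> [|p q fp fq|p q fq]; first by rewrite rmorph0.
  - by rewrite rmorphD /= fp fq addr0.
  - by rewrite rmorphM /= fq mulr0.
have [Z Zf genZ] := @noetherian_mpoly k m (@noetherian_field k) _ ker_ideal.
have [lift liftK] := choice f_surj.
(* The universal point: every point [g] is its image under [g] itself, so by naturality one matrix
   over the coordinate algebra specializes to all [rho V g]. *)
pose univ : points G (Defs.coord G) := idfun.
exists m, Z, (map_mx lift (rho V univ)) => M; split=> [[g <-]|[z [zZ <-]]].
  pose z i : K := g (f 'X_i).
  have gE p : g (f p) = mmap iota z p by rewrite -(lrmorphism_eval (g \o f)).
  exists z; split=> [p /Zf fp|]; first by rewrite -gE fp rmorph0.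
  rewrite (rho_natural V (phi := g) (x := univ)) //.
  by apply/matrixP => i j; rewrite !mxE -gE liftK.
have [|g gE] := eval_lrmorphism f_surj (z := z).
  (* The polynomials that vanish at [z] form an ideal containing [Z], hence containing the kernel of
     [f]. *)
  apply: genZ zZ; split=> [|p q zp zq|p q zq]; first by rewrite rmorph0.
  - by rewrite rmorphD /= zp zq addr0.
  - by rewrite rmorphM /= zq mulr0.
exists g; rewrite (rho_natural V (phi := g) (x := univ)) //.
by apply/matrixP => i j; rewrite !mxE -gE liftK.
Qed.

End Points.

(** * Definable subsets of affine space *)

Section Definable.
Variable K : closedFieldType.

(** Formulas are evaluated on lists; variables of index [N] or more read the default 0. *)
Definition env N (x : 'I_N -> K) : seq K := [seq x i | i <- enum 'I_N].

Lemma nth_env N (x : 'I_N -> K) (i : 'I_N) : (env x)`_i = x i.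
Proof. by rewrite (nth_map i) ?size_enum_ord // nth_ord_enum. Qed.

Lemma nth_env_default N (x : 'I_N -> K) i : (N <= i)%N -> (env x)`_i = 0.
Proof. by move=> leNi; rewrite nth_default // size_map size_enum_ord. Qed.

(** [rterm] excludes inversion, so these are the polynomial functions, with constants from [K]. *)
Definition polyfun N (phi : ('I_N -> K) -> K) : Prop :=
  exists2 t : GRing.term K, GRing.rterm t &
    forall x, phi x = GRing.eval (env x) t.

Definition definable N (S : ('I_N -> K) -> Prop) : Prop :=
  exists2 f : GRing.formula K, GRing.rformula f &
    forall x, S x <-> GRing.holds (env x) f.

Section Closure.
Variable N : nat.
Implicit Types (phi psi : ('I_N -> K) -> K) (S T : ('I_N -> K) -> Prop).

Lemma polyfun_const c : polyfun (fun _ : 'I_N -> K => c).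
Proof. by exists (GRing.Const c). Qed.

Lemma polyfun_var i : polyfun (fun x : 'I_N -> K => x i).
Proof. by exists (GRing.Var _ i) => // x; rewrite /= nth_env. Qed.

Lemma polyfunD phi psi :
  polyfun phi -> polyfun psi -> polyfun (fun x => phi x + psi x).
Proof.
case=> t rt phiE [u ru psiE]; exists (GRing.Add t u) => [|x] /=; first by rewrite rt.
by rewrite phiE psiE.
Qed.

Lemma polyfunM phi psi :
  polyfun phi -> polyfun psi -> polyfun (fun x => phi x * psi x).
Proof.
case=> t rt phiE [u ru psiE]; exists (GRing.Mul t u) => [|x] /=; first by rewrite rt.
by rewrite phiE psiE.
Qed.

Lemma polyfun_sum I (r : seq I) (phi : I -> ('I_N -> K) -> K) :
  (forall i, polyfun (phi i)) -> polyfun (fun x => \sum_(i <- r) phi i x).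
Proof.
move=> phiP; elim: r => [|i r IHr].
  by exists (GRing.Const 0) => // x; rewrite big_nil.
have [t rt tE] := polyfunD (phiP i) IHr.
by exists t => // x; rewrite -tE big_cons.
Qed.

Lemma polyfun_prod I (r : seq I) (phi : I -> ('I_N -> K) -> K) :
  (forall i, polyfun (phi i)) -> polyfun (fun x => \prod_(i <- r) phi i x).
Proof.
move=> phiP; elim: r => [|i r IHr].
  by exists (GRing.Const 1) => // x; rewrite big_nil.
have [t rt tE] := polyfunM (phiP i) IHr.
by exists t => // x; rewrite -tE big_cons.
Qed.

Lemma polyfunX phi n : polyfun phi -> polyfun (fun x => phi x ^+ n).
Proof.
by case=> t rt phiE; exists (GRing.Exp t n) => // x; rewrite phiE.
Qed.

Lemma polyfun_mmap (k : fieldType) (iota : {rmorphism k -> K}) m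
    (z : ('I_N -> K) -> 'I_m -> K) (p : {mpoly k[m]}) :
  (forall i, polyfun (fun x => z x i)) -> polyfun (fun x => mmap iota (z x) p).
Proof.
move=> zP; apply: polyfun_sum => mm; apply: polyfunM; first exact: polyfun_const.
by apply: polyfun_prod => i; apply: polyfunX.
Qed.

Lemma definable_eq phi psi :
  polyfun phi -> polyfun psi -> definable (fun x => phi x = psi x).
Proof.
case=> t rt phiE [u ru psiE]; exists (GRing.Equal t u) => [|x] /=; first by rewrite rt.
by rewrite phiE psiE.
Qed.

Lemma definable_imp S T :
  definable S -> definable T -> definable (fun x => S x -> T x).
Proof.
case=> f rf fP [g rg gP]; exists (GRing.Implies f g) => [|x] /=; first by rewrite rf.
by rewrite fP gP.
Qed.

Lemma definable_all (I : eqType) (r : seq I) (S : I -> ('I_N -> K) -> Prop) :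
  (forall i, definable (S i)) -> definable (fun x => forall i, i \in r -> S i x).
Proof.
move=> defS.
have /choice[f fP] i : exists f : GRing.formula K, GRing.rformula f /\
    forall x, S i x <-> GRing.holds (env x) f.
  by have [f rf fP] := defS i; exists f.
pose g := foldr (fun i => GRing.And (f i)) (GRing.Bool true) r.
exists g => [|x]; rewrite /g.
  by elim: (r) => //= i s ->; have [->] := fP i.
elim: (r) => [|i s IHs] /=; first by split.
rewrite -IHs; have [_ fiP] := fP i; rewrite -fiP; split=> [Srx|[Six Ssx] j].
  by split=> [|j sj]; apply: Srx; rewrite inE ?eqxx ?sj ?orbT.
by rewrite inE => /orP[/eqP ->|/Ssx].
Qed.

Lemma definable_mx_eq m n (A B : ('I_N -> K) -> 'M[K]_(m, n)) :
  (forall i j, polyfun (fun x => A x i j)) ->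
  (forall i j, polyfun (fun x => B x i j)) ->
  definable (fun x => A x = B x).
Proof.
move=> AP BP.
have [ij|f rf fP] := @definable_all _ (enum {: 'I_m * 'I_n})
  (fun ij x => A x ij.1 ij.2 = B x ij.1 ij.2); first exact: definable_eq.
exists f => // x; rewrite -fP; split=> [-> //|AB].
by apply/matrixP => i j; apply: (AB (i, j)); rewrite mem_enum.
Qed.

Lemma polyfun_mulmx m n p (A : ('I_N -> K) -> 'M[K]_(m, n))
    (B : ('I_N -> K) -> 'M[K]_(n, p)) :
  (forall i j, polyfun (fun x => A x i j)) ->
  (forall i j, polyfun (fun x => B x i j)) ->
  forall i j, polyfun (fun x => (A x *m B x) i j).
Proof.
move=> AP BP i j; have [h|t rt tE] :=
  @polyfun_sum _ (index_enum 'I_n) (fun h x => A x i h * B x h j).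
  exact: polyfunM.
by exists t => // x; rewrite -tE mxE.
Qed.

End Closure.

(** * Universal quantification over a block of variables *)

Definition join N M (x : 'I_N -> K) (y : 'I_M -> K) (i : 'I_(N + M)) : K :=
  match split i with inl a => x a | inr b => y b end.

Lemma join_lshift N M (x : 'I_N -> K) (y : 'I_M -> K) i :
  join x y (lshift M i) = x i.
Proof. by rewrite /join (unsplitK (inl i)). Qed.

Lemma join_rshift N M (x : 'I_N -> K) (y : 'I_M -> K) i :
  join x y (rshift N i) = y i.
Proof. by rewrite /join (unsplitK (inr i)). Qed.

Lemma definable_forall N M (S : ('I_(N + M) -> K) -> Prop) :
  definable S -> definable (fun x => forall y : 'I_M -> K, S (join x y)).
Proof.
case=> f rf fP; exists (foldr GRing.Forall f (iota N M)).
  by elim: (iota N M).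
move=> x; split=> [Sx|/GRing.foldForallP fx y].
  apply/GRing.foldForallP => e' ee'.
  (* [e'] agrees with [env x] off the bound block, so [join x y] reproduces it below [N + M]; from
     there on both lists read 0. *)
  pose y (j : 'I_M) := e'`_(N + j).
  apply: GRing.eq_holds (proj1 (fP _) (Sx y)) => i.
  have [ltiNM|leNMi] := ltnP i (N + M); last first.
    rewrite nth_env_default // -ee' ?nth_env_default //.
      exact: leq_trans (leq_addr _ _) leNMi.
    by rewrite !inE mem_iota negb_and -leqNgt leNMi orbT.
  rewrite (nth_env _ (Ordinal ltiNM)).
  case: (splitP (Ordinal ltiNM)) (splitK (Ordinal ltiNM)) => j /= ij <-.
    rewrite join_lshift -ee' ?ij ?nth_env // !inE mem_iota negb_and.
    by rewrite -ltnNge ltn_ord.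
  by rewrite join_rshift /y ij.
apply/fP; apply: fx => i.
rewrite !inE mem_iota negb_and -ltnNge -leqNgt => /orP[ltiN|leNMi].
  rewrite (nth_env _ (Ordinal ltiN)).
  by rewrite (nth_env (join x y) (lshift M (Ordinal ltiN))) join_lshift.
by rewrite !nth_env_default //; apply: leq_trans (leq_addr _ _) leNMi.
Qed.

(** * Quantifier elimination and vanishing patterns *)

Section Pattern.
Variable N : nat.

Lemma rterm_mpoly (t : GRing.term K) : GRing.rterm t ->
  exists p : {mpoly K[N]}, forall x, GRing.eval (env x) t = p.@[x].
Proof.
elim: t => //=.
- move=> i _; have [ltiN|leNi] := ltnP i N.
    exists 'X_(Ordinal ltiN) => x.
    by rewrite mevalXU -(nth_env x (Ordinal ltiN)).
  by exists 0 => x; rewrite meval0 nth_env_default.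
- by move=> c _; exists c%:MP => x; rewrite mevalC.
- by move=> n _; exists n%:R => x; rewrite rmorph_nat.
- move=> t IHt u IHu /andP[/IHt[p pE] /IHu[q qE]].
  by exists (p + q) => x; rewrite pE qE mevalD.
- by move=> t IHt /IHt[p pE]; exists (- p) => x; rewrite pE mevalN.
- by move=> t IHt n /IHt[p pE]; exists (p *+ n) => x; rewrite pE mevalMn.
- move=> t IHt u IHu /andP[/IHt[p pE] /IHu[q qE]].
  by exists (p * q) => x; rewrite pE qE mevalM.
- by move=> t IHt n /IHt[p pE]; exists (p ^+ n) => x; rewrite pE rmorphXn.
Qed.

Definition same_zeros (L : seq {mpoly K[N]}) (x y : 'I_N -> K) : Prop :=
  forall p, p \in L -> (p.@[x] == 0) = (p.@[y] == 0).

Lemma same_zeros_cat L1 L2 x y :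
  same_zeros (L1 ++ L2) x y -> same_zeros L1 x y /\ same_zeros L2 x y.
Proof. by move=> xy; split=> p Lp; apply: xy; rewrite mem_cat Lp ?orbT. Qed.

Lemma qf_form_zeros (f : GRing.formula K) : GRing.qf_form f -> GRing.rformula f ->
  exists L, forall x y, same_zeros L x y ->
    GRing.qf_eval (env x) f = GRing.qf_eval (env y) f.
Proof.
(* The three binary connectives share one argument: concatenate the lists of both subformulas. *)
have binop f1 f2 (op : bool -> bool -> bool) :
  (GRing.qf_form f1 -> GRing.rformula f1 -> exists L, forall x y, same_zeros L x y ->
    GRing.qf_eval (env x) f1 = GRing.qf_eval (env y) f1) ->
  (GRing.qf_form f2 -> GRing.rformula f2 -> exists L, forall x y, same_zeros L x y ->
    GRing.qf_eval (env x) f2 = GRing.qf_eval (env y) f2) ->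
  GRing.qf_form f1 && GRing.qf_form f2 -> GRing.rformula f1 && GRing.rformula f2 ->
  exists L, forall x y, same_zeros L x y ->
    op (GRing.qf_eval (env x) f1) (GRing.qf_eval (env x) f2) =
    op (GRing.qf_eval (env y) f1) (GRing.qf_eval (env y) f2).
- move=> IH1 IH2 /andP[q1 q2] /andP[r1 r2].
  have [[L1 L1P] [L2 L2P]] := (IH1 q1 r1, IH2 q2 r2).
  exists (L1 ++ L2) => x y /same_zeros_cat[z1 z2].
  by rewrite (L1P x y) // (L2P x y).
elim: f => //=.
- by move=> b _ _; exists [::].
- move=> t u _ /andP[/rterm_mpoly[p pE] /rterm_mpoly[q qE]].
  exists [:: p - q] => x y /(_ (p - q) (mem_head _ _)).
  by rewrite !pE !qE !mevalB !subr_eq0.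
- by move=> f1 IH1 f2 IH2; apply: (binop _ _ andb).
- by move=> f1 IH1 f2 IH2; apply: (binop _ _ orb).
- by move=> f1 IH1 f2 IH2; apply: (binop _ _ implb).
- by move=> f IHf qf rf; have [L LP] := IHf qf rf; exists L => x y /LP ->.
Qed.

(** Quantifier elimination over [K] yields an equivalent quantifier-free formula, whose truth
    depends only on which differences of the two sides of its equations vanish. *)
Lemma definable_zeros (S : ('I_N -> K) -> Prop) : definable S ->
  exists L, forall x y, same_zeros L x y -> S x -> S y.
Proof.
case=> f rf fP.
have ok_proj := ClosedFieldQE.holds_ex_elim (@solve_monicpoly K).
have wf_proj := @ClosedFieldQE.wf_ex_elim K.
have /andP[qf' rf'] := GRing.quantifier_elim_wf wf_proj rf.
have [L LP] := qf_form_zeros qf' rf'.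
exists L => x y xy /fP/(GRing.quantifier_elim_rformP wf_proj ok_proj _ rf).
by rewrite (LP _ _ xy) => /(GRing.quantifier_elim_rformP wf_proj ok_proj _ rf)/fP.
Qed.

End Pattern.
End Definable.

(** * Closed subsets of the Grassmannian *)

Lemma meval_scale (K : comNzRingType) N d (p : {mpoly K[N]}) c (x : 'I_N -> K) :
  p \is d.-homog -> p.@[fun j => c * x j] = c ^+ d * p.@[x].
Proof.
move=> /dhomogP hom_p; rewrite !mevalE mulr_sumr !big_seq; apply: eq_bigr => m /hom_p.
rewrite /= => <-; rewrite mulrCA; congr (_ * _).
rewrite mdegE -prodrXr -big_split /=; apply: eq_bigr => j _.
by rewrite exprMn.
Qed.

Section Homogenize.
Variables (K : fieldType) (N : nat).

(** The total degree is [msize p], one more than the degree of a nonzero [p]: this is the usual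
    homogenization times 'X_i. The extra factor is harmless where the [i]-th coordinate is
    nonzero. *)
Definition homogenize (i : 'I_N) (p : {mpoly K[N]}) : {mpoly K[N]} :=
  \sum_(d < msize p) pihomog mdeg d p * 'X_i ^+ (msize p - d).

Lemma homogenize_homog i p : homogenize i p \is (msize p).-homog.
Proof.
apply: rpred_sum => d _; have := ltnW (ltn_ord d); move: (d : nat) => e le_e.
have := dhomogMn (msize p - e) (_ : 'X_i \is 1.-homog); rewrite mul1n => homX.
rewrite -{2}(subnKC le_e); apply: dhomogM; first exact: pihomogP.
by apply: homX; rewrite dhomogX; apply/eqP/mdeg1.
Qed.

Lemma meval_homogenize i p (x : 'I_N -> K) : x i != 0 ->
  (homogenize i p).@[x] = x i ^+ msize p * p.@[fun j => (x i)^-1 * x j].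
Proof.
move=> xi0; rewrite [in X in _ = _ * X](pihomog_partitionE (leqnn (msize p))).
rewrite !raddf_sum mulr_sumr; apply: eq_bigr => d _ /=.
rewrite mevalM rmorphXn /= mevalXU (meval_scale _ _ (pihomogP _ _ _)) exprVn.
rewrite [RHS]mulrA -exprB; [exact: mulrC|exact: ltnW|by rewrite unitfE].
Qed.

End Homogenize.

Local Open Scope classical_set_scope.

(** * Constructibility from finite families of closed sets *)

Section CutOut.
Variable T : topologicalType.
Implicit Types A : set T.

(* Finitely many closed sets separate [A] from its complement. *)
Definition cut_out A : Prop :=
  exists (J : finType) (C : J -> set T), (forall j, closed (C j)) /\
    forall x y, (forall j, C j x <-> C j y) -> A x -> A y.

Lemma locally_closedI (U C : set T) : open U -> closed C -> locally_closed (U `&` C).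
Proof.
move=> opU clC; exists U => //; apply/seteqP; split=> x [Ux].
  by move=> Cx; split=> //; apply: subset_closure.
move=> cl; split=> //; apply: clC; apply: closureS cl; exact: subIsetr.
Qed.

Lemma locally_closed0 : locally_closed (set0 : set T).
Proof. by exists set0; [exact: open0|rewrite set0I]. Qed.

(** The atoms of the family [C] are disjoint and locally closed, and an atom that meets [A] lies in
    [A]. *)
Lemma cut_out_constructible A : cut_out A -> constructible A.
Proof.
case=> J [C [clC CA]].
pose atom (b : {set J}) : set T := [set x | forall j, j \in b <-> C j x].
have lc_atom b : locally_closed (atom b).
  rewrite [atom b](_ : _ = ~` (\bigcup_(j in [set j | j \notin b]) C j) `&`
      \bigcap_(j in [set j | j \in b]) C j).
    apply: locally_closedI; last by apply: closed_bigI => j _; apply: clC.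
    rewrite openC; apply: closed_bigcup => [|j _]; last exact: clC.
    exact: cardinality.finite_finset.
  apply/seteqP; split=> x.
    move=> ax; split; last by move=> j /= /ax.
    by case=> j /= /negP jb /ax.
  move=> [nC Cb] j; split=> [/Cb//|Cjx]; apply: contrapT => /negP jb.
  by apply: nC; exists j.
exists #|{set J}|, (fun i => A `&` atom (enum_val i)); split.
(* The pieces are indexed by all subsets of [J]; an atom that misses [A] contributes the empty
   set. *)
- move=> i; have [[x [Ax ax]]|noA] := pselect (exists x, (A `&` atom (enum_val i)) x).
    rewrite (_ : A `&` _ = atom (enum_val i)); first exact: lc_atom.
    apply/seteqP; split=> y; first by case.
    by move=> ay; split=> //; apply: CA Ax => j; rewrite -(ax j) -(ay j).
  rewrite (_ : A `&` _ = set0); first exact: locally_closed0.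
  by apply/seteqP; split=> // x Ax; apply: noA; exists x.
- move=> i i' _ _ [x [[_ ax] [_ ax']]]; apply: enum_val_inj; apply/setP => j.
  by apply/idP/idP => [/ax/ax'|/ax'/ax].
- apply/seteqP; split=> [x Ax|x [i _ []] //].
  exists (enum_rank [set j | `[< C j x >]]%SET) => //; split=> // j.
  by rewrite enum_rankK inE; split=> [/asboolP|Cjx]; last apply/asboolP.
Qed.

Lemma cut_out_bigcup (I : finType) (A : I -> set T) :
  (forall i, cut_out (A i)) -> cut_out (\bigcup_i A i).
Proof.
move=> cutA.
(* The index type varies with [i], so it is packed with its family before choosing. *)
have /choice[F FP] i : exists F : {J : finType & J -> set T},
    (forall j, closed (tagged F j)) /\
    forall x y, (forall j, tagged F j x <-> tagged F j y) -> A i x -> A i y.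
  by have [J [C CP]] := cutA i; exists (Tagged (fun J : finType => J -> set T) C).
exists {i : I & tag (F i)}, (fun u => tagged (F (tag u)) (tagged u)).
split=> [[i j]|x y xy [i _ Ax]]; first exact: (FP i).1.
exists i => //; apply: (FP i).2 Ax => j; exact: (xy (Tagged (fun i => tag (F i)) j)).
Qed.

End CutOut.

(** * Pluecker coordinates and affine charts *)

Section Grassmannian.
Variables (K : fieldType) (n : nat).
Implicit Type W : grassmannian K n.

Lemma zariski_closed_closed (C : set (grassmannian K n)) :
  zariski_closed C -> closed C.
Proof. by rewrite -openC -{1}[C]setCK. Qed.

Lemma closed_plucker d e (p : {mpoly K[#|{ffun 'I_d -> 'I_n}|]}) :
  p \is e.-homog -> closed [set W : grassmannian K n | \dim W = d /\ p.@[plucker W] = 0].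
Proof.
move=> hom_p; apply: zariski_closed_closed => d'.
have [->|ned] := eqVneq d' d.
  exists [set p]; split=> [_ ->|W dW]; first by exists e.
  by split=> [[_ pW] _ -> //|pW]; split=> //; apply: pW.
(* In every other dimension the polynomial 1 cuts out the empty set. *)
exists [set 1]; split=> [_ ->|W dW]; first by exists 0%N; apply: dhomog1.
split=> [[dW' _]|/(_ 1 erefl)/eqP]; first by rewrite -dW dW' eqxx in ned.
by rewrite meval1 oner_eq0.
Qed.

Definition basis_mx d W : 'M[K]_(d, n) :=
  \matrix_(a < d, j < n) (vbasis (W : {vspace 'cV[K]_n}))`_a j 0.

Definition spans d (B : 'M[K]_(d, n)) W : Prop :=
  forall w : 'cV[K]_n, (w \in (W : {vspace _})) = (w^T <= B)%MS.

Lemma mul_basis_mx d W (u : 'rV[K]_d) :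
  (u *m basis_mx d W)^T = \sum_a u 0 a *: (vbasis (W : {vspace 'cV[K]_n}))`_a.
Proof.
apply/matrixP => j o; rewrite ord1 !mxE summxE.
by apply: eq_bigr => a _; rewrite !mxE.
Qed.

Lemma spans_basis_mx d W : \dim W = d -> spans (basis_mx d W) W.
Proof.
move=> <- w; apply/idP/submxP => [/coord_vbasis wE|[u uE]].
  exists (\row_a coord (vbasis (W : {vspace 'cV[K]_n})) a w).
  apply: trmx_inj; rewrite mul_basis_mx trmxK {1}wE.
  by apply: eq_bigr => a _; rewrite mxE.
rewrite -[w]trmxK uE mul_basis_mx; apply: memv_suml => a _.
by apply: memvZ; apply: vbasis_mem; apply: mem_nth; rewrite size_tuple.
Qed.

Lemma row_free_basis_mx d W : \dim W = d -> row_free (basis_mx d W).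
Proof.
move=> <-; apply: inj_row_free => u /(congr1 trmx); rewrite mul_basis_mx trmx0.
have /andP[_ /freeP freeW] := vbasisP (W : {vspace 'cV[K]_n}).
by move=> /freeW u0; apply/rowP => a; rewrite u0 mxE.
Qed.

Lemma spans_mull d (U : 'M[K]_d) (B : 'M[K]_(d, n)) W :
  U \in unitmx -> spans B W -> spans (U *m B) W.
Proof.
by move=> Uu BW w; rewrite BW (eqmxMfull B) // row_full_unit.
Qed.

Lemma pluckerE d W (i : 'I_#|{ffun 'I_d -> 'I_n}|) :
  plucker W i = \det (colsub (enum_val i) (basis_mx d W)).
Proof. by congr (\det _); apply/matrixP => a b; rewrite !mxE. Qed.

Lemma plucker_neq0 d W : \dim W = d ->
  exists i : 'I_#|{ffun 'I_d -> 'I_n}|, plucker W i != 0.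
Proof.
move=> dW; have fullB : row_full (basis_mx d W)^T.
  by rewrite /row_full mxrank_tr; apply: row_free_basis_mx.
(* A matrix of rank [d] with [d] rows has [d] columns with nonzero minor, found here as rows of the
   transpose. *)
exists (enum_rank (fullrankfun fullB)); rewrite pluckerE enum_rankK.
have := fullrowsub_unit fullB; rewrite unitmxE unitfE -det_tr.
by congr (\det _ != 0); apply/matrixP => a b; rewrite !mxE.
Qed.

(* By Cramer's rule, the minors obtained from the minor [i] by changing one
   column are the entries of [\adj D *m B], where [B] is the basis matrix and
   [D] its submatrix with the columns [i]. *)
Definition chart_mx d (i : 'I_#|{ffun 'I_d -> 'I_n}|)
    (x : 'I_#|{ffun 'I_d -> 'I_n}| -> K) : 'M[K]_(d, n) :=
  \matrix_(a < d, j < n)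
    x (enum_rank [ffun b => if b == a then j else (enum_val i : {ffun _}) b]).

Lemma chart_mxE d W (i : 'I_#|{ffun 'I_d -> 'I_n}|) c :
  chart_mx i (fun j => c * plucker W j) =
  (c *: \adj (colsub (enum_val i) (basis_mx d W))) *m basis_mx d W.
Proof.
apply/matrixP => a j; rewrite -scalemxAl !mxE; congr (_ * _).
(* Laplace expansion along the replaced column [a]: its cofactors do not see that column, so they
   are those of the unmodified minor. *)
rewrite /plucker enum_rankK (expand_det_col _ a); apply: eq_bigr => b _.
rewrite !mxE ffunE eqxx mulrC; congr (_ * _).
rewrite /cofactor; congr (_ * \det _); apply/matrixP => r s; rewrite !mxE ffunE.
by rewrite eq_sym (negbTE (neq_lift _ _)).
Qed.

Lemma spans_chart_mx d W (i : 'I_#|{ffun 'I_d -> 'I_n}|) :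
  \dim W = d -> plucker W i != 0 ->
  spans (chart_mx i (fun j => (plucker W i)^-1 * plucker W j)) W.
Proof.
move=> dW pi0; rewrite chart_mxE; apply: spans_mull (spans_basis_mx dW).
rewrite pluckerE in pi0 *; set D := colsub _ _ in pi0 *.
(* The Pluecker coordinate [i] is the determinant of [D], so the left factor is the inverse of
   [D]. *)
have /mulmx1_unit[] // : ((\det D)^-1 *: \adj D) *m D = 1%:M.
by rewrite -scalemxAl mul_adj_mx scale_scalar_mx mulVf.
Qed.

End Grassmannian.

(** * Isotropy groups *)

Section Isotropy.
Variables (k : fieldType) (K : closedFieldType) (iota : {rmorphism k -> K}).
Variables (G : affineGroup k) (n : nat) (V : representation G n).

(** On transposed vectors [g] acts by right multiplication with the transpose of its matrix, and
    both stability and triviality can be tested on the rows of [B]. *)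
Lemma isotropy_trivial_spans d (B : 'M[K]_(d, n)) (W : grassmannian K n) :
  spans B W ->
  isotropy_trivial iota V W <->
  forall M : 'M[K]_n, (exists g : points G (algebra_along iota), rho V g = M) ->
    (B *m M^T <= B)%MS -> B *m M^T = B.
Proof.
move=> BW; split=> [trivW M [g gM] stabB|trivB g stabW w].
  have stabW : isotropy V W g.
    move=> w; rewrite !BW /act gM trmx_mul => wB.
    exact: submx_trans (submxMr _ wB) stabB.
  apply/row_matrixP => a; apply: trmx_inj.
  have := trivW g stabW (row a B)^T; rewrite BW trmxK row_sub => /(_ isT).
  by rewrite /act gM => <-; rewrite row_mul trmx_mul trmxK.
have BgT : B *m ((rho V g : 'M[K]_n))^T = B.
  apply: trivB; first by exists g.
  apply/row_subP => a; rewrite row_mul -[row a B]trmxK -trmx_mul -BW.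
  by apply: stabW; rewrite BW trmxK row_sub.
rewrite BW => /submxP[u uB]; apply: trmx_inj.
by rewrite /act trmx_mul uB -mulmxA BgT.
Qed.

(** Stability of the row space means that some matrix [C] satisfies [B *m M^T = C *m B]. It occurs
    as a premise, so its existential quantifier becomes universal: one block [y] holds the [m]
    coordinates of the group point and the [d * d] entries of [C]. *)
Lemma definable_isotropy_trivial d (i : 'I_#|{ffun 'I_d -> 'I_n}|) :
  exists2 S : ('I_#|{ffun 'I_d -> 'I_n}| -> K) -> Prop, definable S &
    forall x (W : grassmannian K n),
      spans (chart_mx i x) W -> (isotropy_trivial iota V W <-> S x).
Proof.
have [m [Z [Q pointsP]]] := points_closed iota V.
set N := #|_|.
pose z (y : 'I_(m + d * d) -> K) (h : 'I_m) := y (lshift _ h).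
pose C (y : 'I_(m + d * d) -> K) : 'M[K]_d :=
  \matrix_(a, b) y (rshift m (mxvec_index a b)).
pose T (x : 'I_N -> K) (y : 'I_(m + d * d) -> K) :=
  (forall p, p \in Z -> mmap iota (z y) p = 0) ->
  chart_mx i x *m (map_mx (mmap iota (z y)) Q)^T = C y *m chart_mx i x ->
  chart_mx i x *m (map_mx (mmap iota (z y)) Q)^T = chart_mx i x.
pose l (w : 'I_(N + (m + d * d)) -> K) h := w (lshift _ h).
pose r (w : 'I_(N + (m + d * d)) -> K) h := w (rshift N h).
exists (fun x => forall y, T x y).
  have defT : definable (fun w => T (l w) (r w)).
    have polyE a j : polyfun (fun w => chart_mx i (l w) a j).
      have [t rt tE] := polyfun_var K (lshift (m + d * d) (enum_rank
        [ffun b => if b == a then j else (enum_val i : {ffun _}) b])).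
      by exists t => // w; rewrite -tE mxE.
    have polyz h : polyfun (fun w => z (r w) h) by apply: polyfun_var.
    have polyEQ : forall a j, polyfun (fun w =>
        (chart_mx i (l w) *m (map_mx (mmap iota (z (r w))) Q)^T) a j).
      apply: polyfun_mulmx => // h j.
      have [t rt tE] := polyfun_mmap iota (Q j h) polyz.
      by exists t => // w; rewrite -tE !mxE.
    apply: definable_imp.
      apply: definable_all => p; apply: definable_eq; first exact: polyfun_mmap.
      exact: polyfun_const.
    apply: definable_imp; last exact: definable_mx_eq.
    apply: definable_mx_eq => //; apply: polyfun_mulmx => // a b.
    have [t rt tE] := polyfun_var K (rshift N (rshift m (mxvec_index a b))).
    by exists t => // w; rewrite -tE mxE.
  have [f rf fP] := definable_forall defT.
  exists f => // x; rewrite -fP.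
  have joinl y : l (join x y) = x by apply/funext => h; apply: join_lshift.
  have joinr y : r (join x y) = y by apply/funext => h; apply: join_rshift.
  by split=> Tx y; have := Tx y; rewrite joinl joinr.
move=> x W /isotropy_trivial_spans ->; split=> [trivE y zZ EC|Tx M /pointsP[z0 [zZ <-]]].
  apply: trivE; first by apply/pointsP; exists (z y).
  by rewrite EC submxMl.
case/submxP => D ED.
pose y : 'I_(m + d * d) -> K := join z0 (fun h => mxvec D 0 h).
have zy : z y = z0 by apply/funext => h; apply: join_lshift.
have Cy : C y = D by apply/matrixP => a b; rewrite mxE /y join_rshift mxvecE.
by have := Tx y; rewrite /T zy Cy; apply.
Qed.

Lemma cut_out_chart d (i : 'I_#|{ffun 'I_d -> 'I_n}|) :
  cut_out [set W : grassmannian K n |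
    [/\ \dim W = d, plucker W i != 0 & isotropy_trivial iota V W]].
Proof.
have [S /definable_zeros[L LS] SP] := definable_isotropy_trivial i.
pose homL (p : option 'I_(size L)) : {mpoly K[#|{ffun 'I_d -> 'I_n}|]} :=
  if p is Some j then homogenize i L`_j else 'X_i.
(* [None] gives the whole stratum of dimension [d], [Some None] the locus in it where coordinate [i]
   vanishes, and the rest the zeros of the homogenized polynomials of [L]. *)
pose C (p : option (option 'I_(size L))) : set (grassmannian K n) :=
  [set W | \dim W = d /\ (if p is Some q then homL q else 0).@[plucker W] = 0].
exists _, C; split=> [[[j|]|]|W W' CWW' [dW pW trivW]].
- exact/closed_plucker/homogenize_homog.
- by apply: (@closed_plucker _ _ _ 1); rewrite dhomogX; apply/eqP/mdeg1.
- by apply: (@closed_plucker _ _ _ 0); apply: dhomog0.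
have dW' : \dim W' = d.
  by have [/(_ (conj dW (meval0 _)))[]] := CWW' None.
have pW' : plucker W' i != 0.
  apply: contra_neq pW => pW'; have [_] := CWW' (Some None).
  by rewrite /C /= !mevalXU => /(_ (conj dW' pW'))[].
split=> //.
apply/(SP _ _ (spans_chart_mx dW' pW')).
have /(SP _ _ (spans_chart_mx dW pW)) := trivW.
apply: LS => p /(nthP 0)[j ltj <-].
(* On the chart, a homogenized polynomial vanishes exactly when the original one vanishes at the
   rescaled coordinates. *)
have eq0 U : \dim U = d -> plucker U i != 0 ->
    (L`_j).@[fun h => (plucker U i)^-1 * plucker U h] == 0 <->
    C (Some (Some (Ordinal ltj))) U.
  move=> dU pU; rewrite /C /= meval_homogenize //; split=> [/eqP ->|].
    by rewrite mulr0.
  by case=> _ /eqP; rewrite mulf_eq0 expf_eq0 (negbTE pU) andbF.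
by apply/idP/idP => [/(eq0 W dW pW)/CWW'/eq0|/(eq0 W' dW' pW')/CWW'/eq0]; apply.
Qed.

End Isotropy.

Theorem propositionB (k : fieldType) (K : closedFieldType)
    (iota : {rmorphism k -> K}) (G : affineGroup k) (n : nat)
    (V : representation G n) :
  constructible (fun W : grassmannian K n => isotropy_trivial iota V W).
Proof.
apply: cut_out_constructible.
(* Dimensions are bounded by [n], so there are finitely many charts; they cover because each
   subspace has a nonzero Pluecker coordinate. *)
pose chart (u : {d : 'I_n.+1 & 'I_#|{ffun 'I_d -> 'I_n}|}) :=
  [set W : grassmannian K n | [/\ \dim W = tag u, plucker W (tagged u) != 0 &
    isotropy_trivial iota V W]].
rewrite (_ : (fun W => _) = \bigcup_u chart u).
  by apply: cut_out_bigcup => u; apply: cut_out_chart.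
apply/seteqP; split=> W; last by case=> u _ [].
move=> trivW; have leWn : (\dim W < n.+1)%N.
  by rewrite ltnS; apply: leq_trans (dimvS (subvf W)) _; rewrite dimvf /= /dim /= muln1.
have [i pi0] := plucker_neq0 (erefl (\dim W)).
by exists (Tagged (fun d : 'I_n.+1 => 'I_#|{ffun 'I_d -> 'I_n}|)
  (i : (fun d : 'I_n.+1 => 'I_#|{ffun 'I_d -> 'I_n}|) (Ordinal leWn))).
Qed.
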